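(* Let $\varepsilon>0$ and $\zeta\in(0,1/2]$. There exists an $\varepsilon$-DP (event-level) continual mechanism for the vector version of incremental monotone symmetric norm estimation on $n$ elements and streams of length $T$ such that for each fixed time step $t\in[T]$, with probability at least $2/3$, its output vector $E^t\in\mathbb R^n$ satisfies, simultaneously for all monotone symmetric norms $L$ on $\mathbb R^n$, $$(1+\zeta)^{-1}L(f^t)-\alpha\cdot L(e_1)\le L(E^t)\le(1+\zeta)L(f^t)+\alpha\cdot L(e_1),\qquad \alpha=\tilde O\Big(\frac{\log^4(nT)}{\varepsilon^2\zeta^5}\Big).$$
   Context: Incremental streams over universe $[n]\cup\{\bot\}$: each update inserts one element of $[n]$ or is the empty element $\bot$; $f^t\in\mathbb N^n$ is the frequency vector after $t$ updates. A norm $L$ on $\mathbb R^n$ is monotone if $|f_i|\le|f'_i|$ for all $i$ implies $L(f)\le L(f')$, and symmetric if invariant under permutations of coordinates; $e_1=(1,0,\dots,0)$. Vector version: at each time step the mechanism outputs a vector $E^t\in\mathbb R^n$ whose norms approximate those of $f^t$. A continual mechanism outputs after each update a value depending only on updates so far. Two streams are event-level neighboring if they differ in at most one time step; $\varepsilon$-DP: $\Pr[\mathcal A(u)\in S]\le e^\varepsilon\Pr[\mathcal A(v)\in S]$ for all neighbors and output sets $S$ (output = the whole sequence $E^1,\dots,E^T$). $\tilde O$ hides lower-order polylogarithmic factors (e.g. in $\log(nT)$, $1/\varepsilon$, $1/\zeta$). *)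

(* Defs.v *)
From HB Require Import structures.
From mathcomp Require Import all_boot all_order all_algebra perm.
From mathcomp Require Import all_classical all_reals all_analysis.
Set Implicit Arguments. Unset Strict Implicit. Unset Printing Implicit Defensive.
Import Order.TTheory GRing.Theory Num.Theory.
Local Open Scope classical_set_scope.
Local Open Scope ring_scope.

Section defs.
Variable R : realType.

(* An incremental stream of length T over [n] ∪ {⊥}: update at time s is
   [Some i] (insert i) or [None] (the empty element ⊥).
   Time step t : 'I_T stands for the (t+1)-th update. *)
Definition stream (n T : nat) := 'I_T -> option 'I_n.

Definition freq (n T : nat) (u : stream n T) (t : 'I_T) : 'I_n -> R :=
  fun i => (#|[set s : 'I_T | (s <= t)%N && (u s == Some i)]|)%:R.

Definition neighbors (n T : nat) (u v : stream n T) : Prop :=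
  (#|[set s : 'I_T | u s != v s]| <= 1)%N.

Definition out (n T : nat) := 'I_T -> 'I_n -> R.

(* Borel sigma-algebra on the output space R^(T*n) (product sigma-algebra,
   generated by the coordinate cylinders) *)
Definition out_cyl (n T : nat) : set (set (out n T)) :=
  [set S | exists (t : 'I_T) (i : 'I_n) (B : set R),
      measurable B /\ S = [set x : out n T | B (x t i)]].
Definition out_measurable (n T : nat) : set (set (out n T)) :=
  smallest (sigma_algebra setT) (@out_cyl n T).

(* A randomized mechanism: a deterministic function of the input stream and
   of the internal randomness omega drawn from a probability space. *)
Definition mech_measurable d (Omega : measurableType d) (n T : nat)
  (A : stream n T -> Omega -> out n T) : Prop :=
  forall u S, @out_measurable n T S -> measurable (A u @^-1` S).

Definition continual d (Omega : measurableType d) (n T : nat)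
  (A : stream n T -> Omega -> out n T) : Prop :=
  forall u v (t : 'I_T) omega, (forall s : 'I_T, (s <= t)%N -> u s = v s) ->
    A u omega t = A v omega t.

Definition eps_DP d (Omega : measurableType d) (P : probability Omega R)
  (n T : nat) (A : stream n T -> Omega -> out n T) (eps : R) : Prop :=
  forall u v, neighbors u v -> forall S, @out_measurable n T S ->
    (P (A u @^-1` S) <= (expR eps)%:E * P (A v @^-1` S))%E.

Definition is_norm (n : nat) (L : ('I_n -> R) -> R) : Prop :=
  [/\ forall x, L x = 0 -> x = (fun _ => 0),
      forall (c : R) x, L (fun i => c * x i) = `|c| * L x &
      forall x y, L (fun i => x i + y i) <= L x + L y].
Definition monotone_norm (n : nat) (L : ('I_n -> R) -> R) : Prop :=
  forall x y, (forall i, `|x i| <= `|y i|) -> L x <= L y.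
Definition symmetric_norm (n : nat) (L : ('I_n -> R) -> R) : Prop :=
  forall (s : {perm 'I_n}) x, L (fun i => x (s i)) = L x.
Definition mon_sym_norm (n : nat) (L : ('I_n -> R) -> R) : Prop :=
  [/\ is_norm L, monotone_norm L & symmetric_norm L].

Definition e1 (n : nat) : 'I_n -> R := fun i => if val i == 0%N then 1 else 0.

Definition good_approx (n : nat) (zeta alpha : R) (f E : 'I_n -> R) : Prop :=
  forall L : ('I_n -> R) -> R, mon_sym_norm L ->
    (1 + zeta)^-1 * L f - alpha * L (@e1 n) <= L E /\
    L E <= (1 + zeta) * L f + alpha * L (@e1 n).

(* for each stream and each fixed time t, with probability at least 2/3
   (inner probability: a measurable sub-event of probability >= 2/3) *)
Definition accurate d (Omega : measurableType d) (P : probability Omega R)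
  (n T : nat) (A : stream n T -> Omega -> out n T) (zeta alpha : R) : Prop :=
  forall (u : stream n T) (t : 'I_T), exists G : set Omega,
    [/\ measurable G,
        G `<=` [set omega | good_approx zeta alpha (freq u t) (A u omega t)] &
        ((2%:R / 3%:R)%:E <= P G)%E].

(* alpha = O~(log^4(nT) / (eps^2 zeta^5)): constant C times the main term times
   a polylogarithmic factor in log(nT), 1/eps, 1/zeta *)
Definition alpha_bound (C : R) (k n T : nat) (eps zeta : R) : R :=
  let lnT := ln ((2 * n * T)%:R : R) in
  C * lnT ^+ 4 / (eps ^+ 2 * zeta ^+ 5) *
  (ln (2 + lnT) + ln (2 + eps^-1) + ln (2 + zeta^-1)) ^+ k.

End defs.

(* Main.v *)
(* Since L is monotone and symmetric, L (f^t) only depends on the tail counts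
   #{i | x <= f_i}.  Two families of running sums are released through the
   dyadic tree mechanism: the histogram, accurate for each item up to
   Delta = O(log^2(nT) / eps), and, for O~(1/zeta) geometric levels tau_j below
   the cutoff B + Delta with B = O(Delta / zeta), the number of items of
   frequency at least tau_j.  In an incremental stream each item crosses a level
   at most once, so changing one update moves at most two crossings per stream
   and level, and the level counts have sensitivity O~(1/zeta).  Tail counts
   above B are read off the noisy histogram at multiplicative cost 1 + zeta;
   those below B come from the noisy level counts, and an error of err items at
   level tau_j changes the sorted vector only in a window of 2 err coordinates,
   by at most tau_j, costing 2 err tau_j L(e_1).

   The noise is a geometric law in the cyclic norm of Z/(2M+1).  The group
   action makes additive noise exactly private, so a finite product space
   suffices, and M is large enough for wrap-around not to occur when the noise
   is small.  Chernoff's bound on the sum of the D = O(log T) noise terms of a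
   prefix gives O((D + log k) / rate) simultaneously for k counters. *)
Require Import Defs.
From HB Require Import structures.
From mathcomp Require Import all_boot all_order all_algebra perm.
From mathcomp Require Import all_classical all_reals all_analysis.
From mathcomp Require Import ring lra zify.
Import Order.TTheory GRing.Theory Num.Theory.
Local Open Scope classical_set_scope.
Local Open Scope ring_scope.
Set Implicit Arguments. Unset Strict Implicit. Unset Printing Implicit Defensive.

(** * Finite probability spaces *)

Section FiniteLaw.
Context (R : realType) (F : finType) (p : F -> {nonneg R}).
Hypothesis sum_p : \sum_x (p x)%:num = 1.

(* A law on F is realised on the discrete space nat: k stands for the k-th
   element of enum F. *)
Definition atom_mass (k : nat) : {nonneg R} :=
  if insub k is Some i then p (@enum_val F F i) else 0%:nng.

Definition finite_law : set nat -> \bar R :=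
  msum (fun k => mscale (atom_mass k) (\d_k : {measure set nat -> \bar R})) #|F|.

HB.instance Definition _ := Measure.on finite_law.

(** Indices from [#|F|] on carry no mass, so the default [x0] that [nth] returns there never
    matters. *)
Lemma finite_lawE (x0 : F) (Q : pred F) :
  finite_law [set w | Q (nth x0 (enum F) w)] = (\sum_(x | Q x) (p x)%:num)%:E.
Proof.
rewrite /finite_law /msum /mscale -sumEFin.
transitivity (\sum_(i < #|F|)
    (if Q (@enum_val F F i) then (p (enum_val i))%:num%:E else 0)%E).
  apply: eq_bigr => i _; rewrite /= /mscale /atom_mass.
  case: insubP => [j jF ij|]; last by rewrite ltn_ord.
  have <- : j = i by apply/val_inj.
  rewrite [X in (_ * X)%E](_ : _ = (Q (enum_val j))%:R%:E); last first.
    by rewrite [LHS]diracE mem_setE /= (@enum_val_nth _ _ x0 j).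
  by case: (Q _); rewrite ?mule1 ?mule0.
rewrite [RHS]big_mkcond /= (@big_enum_val _ _ _ F F) /=; apply: eq_bigr => i _.
by case: ifP.
Qed.

Lemma finite_law_setT : finite_law [set: nat] = 1%E.
Proof.
have [x0] : {x : F | true}.
  case: (pickP (predT : pred F)) => [x _|F0]; first by exists x.
  have := sum_p; rewrite big_pred0 ?F0// => /eqP; rewrite eq_sym oner_eq0 //.
move=> _; have := finite_lawE x0 predT; rewrite sum_p => <-.
by congr finite_law; apply/seteqP; split.
Qed.

HB.instance Definition _ :=
  Measure_isProbability.Build _ _ _ finite_law finite_law_setT.

Definition finite_probability : probability nat R := finite_law.

End FiniteLaw.

(** * Cyclic geometric noise *)

Section CyclicNoise.
Variable (M : nat).
Local Notation Z := 'I_M.*2.+1.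

Definition cyc_norm (x : Z) : nat := minn x (M.*2.+1 - x).

(** The centred representative, in [-M, M], of a residue modulo 2M+1. *)
Definition signed_rep (z : Z) : int := if (z <= M)%N then z%:Z else z%:Z - (M.*2.+1)%:Z.

Lemma val_addZ (x y : Z) : val (x + y) = ((x + y) %% M.*2.+1)%N.
Proof. by []. Qed.

Lemma val_oppZ (x : Z) : val (- x) = ((M.*2.+1 - x) %% M.*2.+1)%N.
Proof. by []. Qed.

Lemma cyc_normD (x y : Z) : (cyc_norm (x + y)%R <= cyc_norm x + cyc_norm y)%N.
Proof.
rewrite /cyc_norm val_addZ; have := ltn_ord x; have := ltn_ord y.
have [lt|ge] := ltnP (x + y)%N M.*2.+1; first by rewrite modn_small //; lia.
move=> hy hx; have -> : ((x + y) %% M.*2.+1 = x + y - M.*2.+1)%N.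
  by rewrite -{1}(subnK ge) modnDr modn_small //; lia.
lia.
Qed.

Lemma cyc_normN (x : Z) : cyc_norm (- x)%R = cyc_norm x.
Proof.
rewrite /cyc_norm val_oppZ; have := ltn_ord x.
by have [->|x0] := posnP x; rewrite ?subn0 ?modnn ?modn_small //; lia.
Qed.

Lemma cyc_norm_inZp (c : nat) : (cyc_norm (inZp c) <= c)%N.
Proof. by rewrite /cyc_norm /= geq_min leq_mod. Qed.

Lemma inZpD (a b : nat) : inZp (a + b) = inZp a + inZp b :> Z.
Proof. by apply/val_inj; rewrite /= modnDm. Qed.

Lemma cyc_norm_inZpB (a b : nat) :
  (cyc_norm (inZp a - inZp b)%R <= (a - b) + (b - a))%N.
Proof.
have [ab|/ltnW ab] := leqP a b.
  by rewrite -{1}(subnK ab) inZpD opprD addrC addrNK cyc_normN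
    (leq_trans (cyc_norm_inZp _)) ?leq_addl.
by rewrite -{1}(subnK ab) inZpD addrK (leq_trans (cyc_norm_inZp _)) ?leq_addr.
Qed.

(** Under this bound c plus the centred noise stays inside [-M, M], so decoding involves no
    wrap-around and the error is the noise itself. *)
Lemma signed_rep_inZpD (c : nat) (x : Z) : (c + cyc_norm x <= M)%N ->
  `|signed_rep (inZp c + x) - c%:Z| <= (cyc_norm x)%:Z.
Proof.
rewrite /signed_rep val_addZ /= /cyc_norm; have := ltn_ord x => hx hc.
rewrite (@modn_small c); last by lia.
have [lt|ge] := ltnP (c + x)%N M.*2.+1.
  by rewrite modn_small //; case: ifP; lia.
have -> : ((c + x) %% M.*2.+1 = c + x - M.*2.+1)%N.
  by rewrite -{1}(subnK ge) modnDr modn_small //; lia.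
by case: ifP; lia.
Qed.

Context (R : realType).

(** Each norm from 1 to M is attained exactly twice, at x and at -x. *)
Lemma sum_cyc_norm (F : nat -> R) :
  \sum_(x : Z) F (cyc_norm x) = F 0%N + (\sum_(k < M) F k.+1) *+ 2.
Proof.
rewrite big_ord_recl /=; congr (F _ + _).
rewrite (eq_bigr (fun i : 'I_M.*2 => F (minn i.+1 (M.*2 - i)))); last first.
  by move=> i _; congr F; rewrite /cyc_norm /= /bump /=; lia.
rewrite -(big_mkord xpredT (fun i => F (minn i.+1 (M.*2 - i)))).
rewrite (@big_cat_nat _ _ _ M) //=; last by lia.
rewrite mulr2n; congr (_ + _).
  by rewrite big_mkord; apply: eq_bigr => i _; congr F; have := ltn_ord i; lia.
rewrite big_nat_rev /= -{1}[M]add0n big_addn -addnn addnK big_mkord.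
by apply: eq_bigr => i _; congr F; have := ltn_ord i; lia.
Qed.

(** Pair the powers: s^(2k+1) and s^(2k+2) are both at most (s^2)^k. The constants depend on neither
    s nor m, which makes the moment bound of the noise uniform in the rate and in M. *)
Lemma sum_pow_le (s : R) (m : nat) : 0 <= s <= 1 ->
  \sum_(k < m) s ^+ k.+1 <= 2 + 2 * \sum_(k < m) (s ^+ 2) ^+ k.+1.
Proof.
move=> /andP[s0 s1].
have s2k k : 0 <= (s ^+ 2) ^+ k by rewrite !exprn_ge0.
have sk k : 0 <= s ^+ k by rewrite exprn_ge0.
have H : \sum_(k < m.*2) s ^+ k.+1 <= 2 * \sum_(k < m) (s ^+ 2) ^+ k.
  elim: m => [|m IH]; first by rewrite !big_ord0 mulr0.
  rewrite doubleS !big_ord_recr /= mulrDr -addrA lerD //.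
  rewrite -exprM mulSn -mul2n.
  have h1 : s ^+ (2 * m).+1 <= s ^+ (2 * m) by rewrite exprS ler_piMl.
  have h2 : s ^+ (2 * m).+2 <= s ^+ (2 * m).+1 by rewrite [leLHS]exprS ler_piMl.
  lra.
have H1 : \sum_(k < m) s ^+ k.+1 <= \sum_(k < m.*2) s ^+ k.+1.
  rewrite -(big_mkord xpredT (fun k => s ^+ k.+1)).
  rewrite -(big_mkord xpredT (fun k => s ^+ k.+1)).
  by rewrite [leRHS](@big_cat_nat _ _ _ m) //=; [rewrite lerDl sumr_ge0|lia].
have H2 : \sum_(k < m) (s ^+ 2) ^+ k <= 1 + \sum_(k < m) (s ^+ 2) ^+ k.+1.
  case: m {H H1} => [|m]; first by rewrite !big_ord0; lra.
  rewrite big_ord_recl /= expr0 lerD2l big_ord_recr /=.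
  rewrite -[leLHS]addr0; apply: lerD => //.
lra.
Qed.

End CyclicNoise.

(** * Independent geometric noise: privacy and concentration *)

Section ProductNoise.
Context (R : realType) (M : nat) (V : finType) (a : V -> R).
Hypothesis a_ge0 : forall v, 0 <= a v.
Local Notation Z := 'I_M.*2.+1.

Definition geom_weight (r : R) (x : Z) : R := expR (- (r * (cyc_norm x)%:R)).

Definition geom_mass (r : R) (x : Z) : R :=
  geom_weight r x / \sum_y geom_weight r y.

Definition noise_mass (w : {ffun V -> Z}) : R := \prod_v geom_mass (a v) (w v).

Lemma sum_geom_weight_gt0 r : 0 < \sum_(y : Z) geom_weight r y.
Proof.
rewrite (bigD1 ord0) //= ltr_wpDr ?expR_gt0 //.
by apply: sumr_ge0 => *; exact: expR_ge0.
Qed.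

Lemma geom_mass_ge0 r x : 0 <= geom_mass r x.
Proof. by rewrite divr_ge0 ?expR_ge0 // ltW // sum_geom_weight_gt0. Qed.

Lemma noise_mass_ge0 w : 0 <= noise_mass w.
Proof. by apply: prodr_ge0 => v _; exact: geom_mass_ge0. Qed.

Lemma sum_geom_mass r : \sum_x geom_mass r x = 1.
Proof. by rewrite -mulr_suml divff // gt_eqF // sum_geom_weight_gt0. Qed.

Lemma sum_noise_mass : \sum_w noise_mass w = 1.
Proof.
rewrite /noise_mass -(bigA_distr_bigA (fun v x => geom_mass (a v) x)) big1 //.
by move=> v _; exact: sum_geom_mass.
Qed.

(** The normalising constants do not depend on the centre, so only the weights compare, and the
    triangle inequality of the cyclic norm bounds their ratio in each coordinate. *)
Lemma noise_mass_shift (z c c' : {ffun V -> Z}) :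
  noise_mass (z - c) <=
  expR (\sum_v a v * (cyc_norm (c v - c' v))%:R) * noise_mass (z - c').
Proof.
rewrite expR_sum -big_split /=; apply: ler_prod => v _.
rewrite geom_mass_ge0 /= mulrA ler_pM2r ?invr_gt0 ?sum_geom_weight_gt0 //.
rewrite /geom_weight -expRD ler_expR.
rewrite -mulrBr -mulrN ler_wpM2l //.
rewrite lerBrDr addrC lerBlDr !ffunE -natrD ler_nat.
by apply: leq_trans (cyc_normD _ _); rewrite [X in (_ <= cyc_norm X)%N]addrC addrA addrNK.
Qed.

(** Translation is a bijection of the group, so c + w has mass [noise_mass (z - c)] at z exactly.
    Since Q is arbitrary, any post-processing is covered. *)
Lemma noise_private (Q : pred {ffun V -> Z}) (c c' : {ffun V -> Z})
    (eps : R) :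
  \sum_v a v * (cyc_norm (c v - c' v))%:R <= eps ->
  \sum_(w | Q (c + w)) noise_mass w <=
  expR eps * \sum_(w | Q (c' + w)) noise_mass w.
Proof.
move=> Heps; have shift (d : {ffun V -> Z}) :
    \sum_(w | Q (d + w)) noise_mass w = \sum_(z | Q z) noise_mass (z - d).
  rewrite (reindex_inj (addIr (- d))) /=.
  by apply: eq_bigl => z; rewrite addrC addrNK.
rewrite !shift mulr_sumr; apply: ler_sum => z _.
apply: le_trans (noise_mass_shift z c c') _.
by rewrite ler_wpM2r ?noise_mass_ge0 ?ler_expR.
Qed.

(** With s = exp(-r/2) the moment is the ratio of the normalisers at rates r/2 and r. If S is the
    sum of the powers of s^2, it is at most (5 + 4S) / (1 + 2S) <= 5. *)
Lemma geom_moment r : 0 <= r ->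
  \sum_(x : Z) geom_mass r x * expR (r / 2 * (cyc_norm x)%:R) <= 5.
Proof.
move=> r0; set s := expR (- (r / 2)).
have s01 : 0 <= s <= 1 by rewrite expR_ge0 expR_le1; lra.
have weightE (x : Z) : geom_weight r x = (s ^+ 2) ^+ cyc_norm x.
  by rewrite -exprM /s -expRM_natr natrM /geom_weight; congr expR; field.
have -> : \sum_(x : Z) geom_mass r x * expR (r / 2 * (cyc_norm x)%:R) =
    (\sum_(x : Z) s ^+ cyc_norm x) / \sum_(x : Z) (s ^+ 2) ^+ cyc_norm x.
  rewrite mulr_suml; apply: eq_bigr => x _.
  rewrite /geom_mass mulrAC (eq_bigr _ (fun y _ => weightE y)); congr (_ / _).
  by rewrite /geom_weight -expRD /s -expRM_natr; congr expR; field.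
have W0 := sum_geom_weight_gt0 r; rewrite (eq_bigr _ (fun y _ => weightE y)) in W0.
rewrite ler_pdivrMr //.
rewrite (sum_cyc_norm M (fun k => s ^+ k)) (sum_cyc_norm M (fun k => (s ^+ 2) ^+ k)).
have := sum_pow_le M s01; rewrite !expr0 !mulr2n.
have : 0 <= \sum_(k < M) (s ^+ 2) ^+ k.+1.
  by apply: sumr_ge0 => k _; rewrite !exprn_ge0 //; case/andP: s01.
lra.
Qed.

(* Markov's inequality for the exponential moment at half the decay rate. *)
Lemma noise_concentration (U : {pred V}) (r : R) (b : nat) :
  0 <= r -> (forall v, v \in U -> a v = r) ->
  \sum_(w : {ffun V -> Z} | (b < \sum_(v in U) cyc_norm (w v))%N) noise_mass w <=
  5 ^+ #|U| / expR (r / 2 * b.+1%:R).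
Proof.
move=> r0 Ur; rewrite ler_pdivlMr ?expR_gt0 //.
pose G v (x : Z) := geom_mass (a v) x *
  (if v \in U then expR (r / 2 * (cyc_norm x)%:R) else 1).
apply: (@le_trans _ _ (\sum_(w : {ffun V -> Z}) \prod_v G v (w v))).
  rewrite mulr_suml big_mkcond; apply: ler_sum => w _; case: ifP => [bU|_].
    rewrite big_split /= ler_wpM2l ?noise_mass_ge0 //.
    rewrite -big_mkcond /= -expR_sum ler_expR -mulr_sumr -natr_sum.
    by rewrite ler_wpM2l ?ler_nat //; lra.
  apply: prodr_ge0 => v _; rewrite mulr_ge0 ?geom_mass_ge0 //.
  by case: ifP => // _; exact: expR_ge0.
(* The moment factorises: a coordinate in U contributes at most 5, any other one its total mass
   1. *)
rewrite -(bigA_distr_bigA G) -prodr_const [leRHS]big_mkcond /=.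
apply: ler_prod => v _; rewrite /G; apply/andP; split.
  apply: sumr_ge0 => x _; rewrite mulr_ge0 ?geom_mass_ge0 //.
  by case: ifP => // _; exact: expR_ge0.
case: ifP => [vU|_]; first by rewrite (Ur _ vU) geom_moment.
by rewrite (eq_bigr (geom_mass (a v))) ?sum_geom_mass // => x _; rewrite mulr1.
Qed.

End ProductNoise.

(** * Dyadic tree counters *)

Section DyadicTree.
Context (T D : nat) (H : finType).
Implicit Types (phi : H -> 'I_T -> bool).

Local Notation node := ('I_D * 'I_T.+1 * H)%type.

(* Node (l, q) is the dyadic block [(q - 1) 2^l, q 2^l) for odd q and is empty
   for even q. *)
Definition in_block (l q s : nat) : bool :=
  ((q - odd q) * 2 ^ l <= s < q * 2 ^ l)%N.

Definition node_count phi (v : node) : nat :=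
  \sum_(s < T | in_block v.1.1 v.1.2 s) phi v.2 s.

(** If bit l of N is set, this is the block of length 2^l in the binary decomposition of [0, N);
    otherwise the block is empty. Every prefix thus reads exactly D nodes. *)
Definition prefix_node (h : H) (N : 'I_T.+1) (l : 'I_D) : node :=
  (l, inord (N %/ 2 ^ l), h).

(** The levels below d tile the part of [0, N) above N rounded down to a multiple of 2^d. Level d
    adds the gap between two successive roundings. *)
Lemma sum_blocks (N d : nat) (f : nat -> nat) :
  (\sum_(l < d) \sum_(s < T | in_block l (N %/ 2 ^ l) s) f s =
  \sum_(s < T | N %/ 2 ^ d * 2 ^ d <= s < N) f s)%N.
Proof.
elim: d => [|d IH].
  by rewrite big_ord0 big1 // => s; rewrite expn0 muln1 divn1; lia.
rewrite big_ord_recr /= IH; set q := (N %/ 2 ^ d)%N.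
(* Rounding to a multiple of 2^(d+1) clears the last bit of q. *)
have qE : (N %/ 2 ^ d.+1 * 2 ^ d.+1 = (q - odd q) * 2 ^ d)%N.
  have -> : (q - odd q = q./2.*2)%N by rewrite -{1}(odd_double_half q) addKn.
  by rewrite expnSr divnMA -/q divn2 -muln2 mulnA mulnAC.
rewrite qE big_mkcond [X in (_ + X)%N]big_mkcond [RHS]big_mkcond /=.
rewrite -big_split /=; apply: eq_bigr => s _.
rewrite /in_block; have := leq_trunc_div N (2 ^ d); rewrite -/q => qN.
have : ((q - odd q) * 2 ^ d <= q * 2 ^ d)%N by rewrite leq_mul2r leq_subr orbT.
set x := ((q - odd q) * 2 ^ d)%N; set y := (q * 2 ^ d)%N in qN *.
by move=> xy; case: (leqP y s); case: (leqP x s); case: (ltnP s N);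
  case: (ltnP s y) => //=; lia.
Qed.

Lemma sum_prefix_nodes phi h (N : 'I_T.+1) : (T < 2 ^ D)%N ->
  (\sum_(l < D) node_count phi (prefix_node h N l) =
  \sum_(s < T | (s < N)%N) phi h s)%N.
Proof.
move=> T_lt; pose f (s : nat) : nat := if insub s is Some s' then phi h s' else 0%N.
have fE (s : 'I_T) : f s = phi h s by rewrite /f valK.
transitivity (\sum_(l < D) \sum_(s < T | in_block l (N %/ 2 ^ l) s) f s)%N.
  apply: eq_bigr => l _; rewrite /node_count /prefix_node /=.
  rewrite inordK; last by rewrite ltnS (leq_trans (leq_div _ _)) // -ltnS.
  by apply: eq_bigr => s _; rewrite fE.
rewrite sum_blocks divn_small ?mul0n; last by have := ltn_ord N; lia.
by apply: eq_big => [s|s _]; rewrite ?fE.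
Qed.

Lemma node_count_causal phi phi' h (N : 'I_T.+1) (l : 'I_D) :
  (forall s : 'I_T, (s < N)%N -> phi h s = phi' h s) ->
  node_count phi (prefix_node h N l) = node_count phi' (prefix_node h N l).
Proof.
move=> eq_phi; apply: eq_bigr => s /andP[_]; rewrite /= inordK; last first.
  by rewrite ltnS (leq_trans (leq_div _ _)) // -ltnS.
by move=> sN; rewrite eq_phi // (leq_trans sN) // leq_trunc_div.
Qed.

Lemma sum_nodes (R : nmodType) (F : node -> R) :
  \sum_v F v = \sum_h \sum_(l < D) \sum_(q < T.+1) F (l, q, h).
Proof.
under [RHS]eq_bigr do rewrite pair_bigA.
by rewrite exchange_big pair_bigA; apply: eq_bigr => -[[l q] h].
Qed.

Lemma prefix_node_inj h (N : 'I_T.+1) : injective (prefix_node h N).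
Proof. by move=> l l' []. Qed.

Lemma node_count_le phi v : (node_count phi v <= T)%N.
Proof.
apply: (@leq_trans (\sum_(s < T) 1)%N); last by rewrite sum1_card card_ord.
by rewrite /node_count big_mkcond; apply: leq_sum => s _; case: ifP => // _; case: (phi _ _).
Qed.

(** The index q can only be s / 2^l + 1. Hence one changed step touches at most one node per level,
    which is the factor D in the sensitivity. *)
Lemma card_blocks (l : 'I_D) (s : 'I_T) :
  (\sum_(q < T.+1 | in_block l q s) 1 <= 1)%N.
Proof.
rewrite sum1_card; apply/card_le1_eqP => q q' hq hq'; apply/val_inj.
have blockE (x : nat) : in_block l x s -> x = (s %/ 2 ^ l).+1.
  move=> /andP[lo hi]; have p0 : (0 < 2 ^ l)%N by rewrite expn_gt0.
  have : (s %/ 2 ^ l < x)%N by rewrite ltn_divLR.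
  have : (x - odd x <= s %/ 2 ^ l)%N by rewrite leq_divRL.
  by case: (odd x); lia.
exact: etrans (blockE _ hq') (esym (blockE _ hq)).
Qed.

Definition nat_dist (a b : nat) : nat := (a - b) + (b - a).

Lemma node_sensitivity phi phi' h :
  (\sum_(l < D) \sum_(q < T.+1)
      nat_dist (node_count phi (l, q, h)) (node_count phi' (l, q, h)) <=
  D * \sum_(s < T) (phi h s != phi' h s))%N.
Proof.
rewrite -[D in leqRHS]card_ord -sum_nat_const; apply: leq_sum => l _.
apply: (@leq_trans
    (\sum_(q < T.+1) \sum_(s < T | in_block l q s) (phi h s != phi' h s))%N).
  apply: leq_sum => q _; rewrite /node_count /=.
  elim/big_ind3: _ => // [a a' b b' c c'|s _]; rewrite /nat_dist; first lia.
  by case: (phi _ _); case: (phi' _ _).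
rewrite (exchange_big_dep xpredT) //=; apply: leq_sum => s _.
by case: (_ != _); [exact: card_blocks|rewrite big1].
Qed.

End DyadicTree.

(** * Insertion and level-crossing events, and their sensitivity *)

Section Features.
Context (T : nat).

Lemma sum_ltS (N : nat) (F : 'I_T -> nat) :
  (\sum_(s < T | (s < N.+1)%N) F s =
   \sum_(s < T | (s < N)%N) F s + oapp F 0 (insub N))%N.
Proof.
case: insubP => [r _ rN|nN] /=.
  rewrite (bigD1 r) /=; last by rewrite rN.
  rewrite addnC; congr (_ + _)%N; apply: eq_bigl => s.
  by rewrite -val_eqE /= rN ltnS andbC -ltn_neqAle.
rewrite addn0; apply: eq_bigl => s; have := ltn_ord s; lia.
Qed.

(** A running count grows by at most 1 per step, so it is incremented to the positive value k once
    if it ever reaches k, and never otherwise. *)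
Lemma sum_crossing (b : 'I_T -> bool) (k N : nat) : (0 < k)%N ->
  (\sum_(s < T | (s < N)%N) (b s && (\sum_(r < T | (r < s.+1)%N) b r == k)) =
   (k <= \sum_(s < T | (s < N)%N) b s))%N.
Proof.
move=> k0; elim: N => [|N IH].
  by rewrite !big_pred0 // leqNgt k0.
rewrite !sum_ltS IH; case: insubP => [r _ rN|_] /=; last by rewrite !addn0.
rewrite sum_ltS rN; have -> : insub N = Some r by rewrite -rN valK.
rewrite /=; set S := (\sum_(s < T | _) b s)%N.
case: (b r) => /=; last by rewrite !addn0.
rewrite addn1 [in RHS]leq_eqVlt ltnS (eq_sym k).
by case: (S.+1 =P k) => [<-|_]; rewrite ?ltnn ?addn0.
Qed.

Variables (n m : nat) (tau : 'I_m -> nat).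
Implicit Types (u v : stream n T) (i : 'I_n) (j : 'I_m).

Definition hits u i (N : nat) : nat := \sum_(s < T | (s < N)%N) (u s == Some i).

Definition crosses u (k : nat) i (s : 'I_T) : bool :=
  (u s == Some i) && (hits u i s.+1 == k).

(** Histogram entries and level counts are both encoded as 0/1 event streams, so that one tree
    construction on prefix sums serves the two families. *)
Definition feature u (h : 'I_n + 'I_m) (s : 'I_T) : bool :=
  match h with
  | inl i => u s == Some i
  | inr j => if u s is Some i then hits u i s.+1 == tau j else false
  end.

Lemma feature_inr u j s : feature u (inr j) s = (\sum_i crosses u (tau j) i s)%N :> nat.
Proof.
rewrite /feature /crosses; case: (u s) => [i0|]; last by rewrite big1.
rewrite (bigD1 i0) //= eqxx big1 ?addn0 // => i i0i.
by rewrite (inj_eq Some_inj) eq_sym (negbTE i0i).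
Qed.

Lemma sum_feature_inr u j (N : nat) : (0 < tau j)%N ->
  (\sum_(s < T | (s < N)%N) feature u (inr j) s =
   \sum_i (tau j <= hits u i N))%N.
Proof.
move=> t0; rewrite (eq_bigr (fun s => (\sum_i crosses u (tau j) i s)%N)); last first.
  by move=> s _; exact: feature_inr.
rewrite exchange_big /=; apply: eq_bigr => i _.
exact: (sum_crossing (fun s => u s == Some i)).
Qed.

Lemma hits_causal u v i (N : nat) :
  (forall s : 'I_T, (s < N)%N -> u s = v s) -> hits u i N = hits v i N.
Proof. by move=> uv; apply: eq_bigr => s /uv ->. Qed.

Lemma feature_causal u v h (N : nat) (s : 'I_T) :
  (forall s : 'I_T, (s < N)%N -> u s = v s) -> (s < N)%N ->
  feature u h s = feature v h s.
Proof.
move=> uv sN; case: h => [i|j] /=; rewrite (uv _ sN) //.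
case: (v s) => // i; rewrite (@hits_causal u v) // => r rs.
by apply: uv; apply: leq_trans sN.
Qed.

Lemma card_classical (p : pred 'I_T) :
  #|[set s : 'I_T | p s]%classic| = #|[pred s | p s]|.
Proof.
by apply: eq_card => s; apply/idP/idP => [/set_mem|sp]; [|exact: mem_set].
Qed.

Lemma freqE (R : realType) u (t : 'I_T) i : freq R u t i = (hits u i t.+1)%:R.
Proof.
rewrite /freq (card_classical (fun s : 'I_T => (s <= t)%N && (u s == Some i))).
by rewrite -sum1_card /hits big_mkcondr.
Qed.

Lemma neighborsP u v : (0 < T)%N -> neighbors u v ->
  exists r : 'I_T, forall s, s != r -> u s = v s.
Proof.
move=> T0; rewrite /neighbors (card_classical (fun s => u s != v s)) => uv.
case: (pickP (fun s => u s != v s)) => [r ur|eq]; last first.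
  (* When u and v agree everywhere, any time step serves as r. *)
  by exists (Ordinal T0) => s _; apply/eqP; have := eq s => /= /negbFE.
exists r => s sr; apply/eqP; apply: contraNT sr => us.
by move/card_le1_eqP: uv => /(_ s r) ->.
Qed.

Lemma sum_eq_Some_le1 (o : option 'I_n) : (\sum_i (o == Some i) <= 1)%N.
Proof.
case: o => [i0|]; last by rewrite big1.
rewrite (bigD1 i0) //= eqxx big1 ?addn0 // => i i0i.
by rewrite (inj_eq Some_inj) eq_sym (negbTE i0i).
Qed.

Lemma feature_inl_sensitivity u v : (0 < T)%N -> neighbors u v ->
  (\sum_i \sum_(s < T) (feature u (inl i) s != feature v (inl i) s) <= 2)%N.
Proof.
move=> T0 /(neighborsP T0)[r uv].
rewrite exchange_big /= (bigD1 r) //= [X in (_ + X)%N]big1 ?addn0; last first.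
  by move=> s /uv ->; rewrite big1 // => i _; rewrite eqxx.
apply: (@leq_trans (\sum_i ((u r == Some i) + (v r == Some i)))%N).
  by apply: leq_sum => i _ /=; case: (u r == _); case: (v r == _).
by rewrite big_split /= (leq_add (sum_eq_Some_le1 _) (sum_eq_Some_le1 _)).
Qed.

Lemma sum_crosses_le1 u k i : (0 < k)%N -> (\sum_(s < T) crosses u k i s <= 1)%N.
Proof.
move=> k0; rewrite (eq_bigl (fun s : 'I_T => (s < T)%N)); last first.
  by move=> s; rewrite ltn_ord.
by rewrite (sum_crossing (fun s => u s == Some i)) // leq_b1.
Qed.

(* Changing one update only affects the crossings of the items it involves,
   and each item crosses level tau j at most once in each stream. *)
Lemma feature_inr_sensitivity u v j : (0 < T)%N -> (0 < tau j)%N ->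
  neighbors u v ->
  (\sum_(s < T) (feature u (inr j) s != feature v (inr j) s) <= 4)%N.
Proof.
move=> T0 t0 /(neighborsP T0)[r uv].
(* The weight w is 0 on items whose insertions agree in u and v, and its total is at most 2. *)
pose k := tau j; pose w i := ((u r == Some i) + (v r == Some i))%N.
have same i : w i = 0%N -> forall s, (u s == Some i) = (v s == Some i).
  rewrite /w => /eqP; rewrite addn_eq0 !eqb0 => /andP[ui vi] s.
  by have [->|/uv->//] := eqVneq s r; rewrite (negbTE ui) (negbTE vi).
have crosses_eq i s : w i = 0%N -> crosses u k i s = crosses v k i s.
  move=> /same wi; rewrite /crosses wi; congr (_ && (_ == _)).
  by apply: eq_bigr => s' _; rewrite wi.
(* Each time at which the features differ is charged to a crossing of an item of positive weight.
   Total weight 2, with at most one crossing per item in each of the two streams, gives 4. *)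
apply: (@leq_trans
    (\sum_(s < T) \sum_i w i * (crosses u k i s + crosses v k i s))%N).
  apply: leq_sum => s _.
  have -> : (feature u (inr j) s != feature v (inr j) s) =
      (nat_of_bool (feature u (inr j) s) != nat_of_bool (feature v (inr j) s)).
    by do 2 case: feature.
  rewrite !feature_inr -/k.
  case: (posnP (\sum_i w i * (crosses u k i s + crosses v k i s))) => [/eqP|]; last first.
    by move=> h; apply: leq_trans h; exact: leq_b1.
  rewrite sum_nat_eq0 => /forallP h; apply: (@leq_trans 0) => //; rewrite leqn0 eqb0 negbK; apply/eqP.
  apply: eq_bigr => i _; move: (h i) => /=; rewrite muln_eq0 addn_eq0.
  case/orP => [/eqP/crosses_eq -> //|/andP[/eqP -> /eqP ->] //].
rewrite exchange_big /=; apply: (@leq_trans (\sum_i w i * 2)%N).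
  apply: leq_sum => i _; rewrite -big_distrr leq_mul2l big_split /=.
  by rewrite (leq_add (sum_crosses_le1 _ _ t0) (sum_crosses_le1 _ _ t0)) orbT.
rewrite -big_distrl big_split /= -[4%N]/(2 * 2)%N leq_mul2r /=.
by rewrite (leq_add (sum_eq_Some_le1 _) (sum_eq_Some_le1 _)).
Qed.

End Features.

(** * Monotone symmetric norms and sorted vectors *)

Section MonotoneSymmetricNorms.
Context (R : realType) (n : nat) (L : ('I_n -> R) -> R).
Hypothesis L_mon_sym : mon_sym_norm L.

Let L_scale (c : R) x : L (fun i => c * x i) = `|c| * L x.
Proof. by case: L_mon_sym => -[_ H _] _ _; exact: H. Qed.

Let L_triangle x y : L (fun i => x i + y i) <= L x + L y.
Proof. by case: L_mon_sym => -[_ _ H] _ _; exact: H. Qed.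

Lemma mon_sym_norm0 : L (fun _ => 0) = 0.
Proof.
rewrite (_ : (fun _ => 0) = fun i : 'I_n => 0 * (0 : R)); last first.
  by apply/funext => i; rewrite mul0r.
by rewrite (L_scale 0 (fun _ => 0)) normr0 mul0r.
Qed.

Lemma mon_sym_norm_le x y : (forall i, 0 <= x i <= y i) -> L x <= L y.
Proof.
case: L_mon_sym => _ H _ xy; apply: H => i.
have /andP[x0 xyi] := xy i.
by rewrite !ger0_norm // (le_trans x0).
Qed.

Lemma mon_sym_norm_ge0 x : 0 <= L x.
Proof.
rewrite -mon_sym_norm0; case: L_mon_sym => _ H _; apply: H => i.
by rewrite normr0.
Qed.

Lemma mon_sym_norm_delta (k : 'I_n) : L (fun i => (i == k)%:R) = L (@e1 R n).
Proof.
pose i0 : 'I_n := Ordinal (leq_ltn_trans (leq0n k) (ltn_ord k)).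
case: L_mon_sym => _ _ /(_ (tperm k i0) (@e1 R n)) <-; congr L; apply/funext => i.
have -> : (i == k) = (tperm k i0 i == i0).
  by rewrite -[X in _ = (_ == X)](tpermL k i0) (inj_eq perm_inj).
by rewrite /e1 -val_eqE; case: (val _ == _).
Qed.

Lemma mon_sym_norm_sum (I : Type) (r : seq I) (P : pred I) (F : I -> 'I_n -> R) :
  L (fun i => \sum_(a <- r | P a) F a i) <= \sum_(a <- r | P a) L (F a).
Proof.
elim: r => [|a r IH].
  rewrite big_nil (_ : (fun i => _) = fun _ => 0) ?mon_sym_norm0 //.
  by apply/funext => i; rewrite big_nil.
rewrite big_cons; case: ifP => Pa.
  apply: le_trans (lerD (lexx _) IH); apply: le_trans (L_triangle _ _).
  rewrite le_eqVlt; apply/orP/or_introl/eqP; congr L; apply/funext => i.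
  by rewrite big_cons Pa.
apply: le_trans IH; rewrite le_eqVlt; apply/orP/or_introl/eqP; congr L.
by apply/funext => i; rewrite big_cons Pa.
Qed.

(** Split each window into unit vectors: by symmetry each of them has norm L(e_1). *)
Lemma mon_sym_norm_windows (m : nat) (tau : 'I_m -> nat) (W : 'I_m -> {set 'I_n}) :
  L (fun k => \sum_j (tau j)%:R * (k \in W j)%:R) <=
  (\sum_j (tau j)%:R * (#|W j|)%:R) * L (@e1 R n).
Proof.
apply: (le_trans (mon_sym_norm_sum _ _ _)).
rewrite mulr_suml; apply: ler_sum => j _.
rewrite L_scale ger0_norm // -mulrA ler_wpM2l //.
rewrite (_ : (fun k => _) = fun k => \sum_(w in W j) (k == w)%:R :> R); last first.
  apply/funext => k; have [kW|kW] := boolP (k \in W j).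
    by rewrite (bigD1 k) //= eqxx big1 ?addr0 // => w /andP[_ /negbTE]; rewrite eq_sym => ->.
  by rewrite big1 // => w wW; case: eqP kW => // ->; rewrite wW.
apply: (le_trans (mon_sym_norm_sum _ _ _)).
rewrite (eq_bigr (fun _ => L (@e1 R n))); last by move=> w _; exact: mon_sym_norm_delta.
by rewrite sumr_const mulr_natl.
Qed.

End MonotoneSymmetricNorms.

(** Coordinatewise domination up to a permutation passes to all monotone symmetric norms at once. In
    the lower hypothesis 1 + zeta also multiplies g, because the conclusion divides by it. *)
Lemma good_approx_of_windows (R : realType) (n m : nat) (tau : 'I_m -> nat)
    (W : 'I_m -> {set 'I_n}) (zeta alpha : R) (f E : 'I_n -> R) (s : {perm 'I_n}) :
  0 < zeta -> (forall i, 0 <= f i) -> (forall i, 0 <= E i) ->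
  let g k := \sum_j (tau j)%:R * (k \in W j)%:R in
  (forall k, f (s k) <= (1 + zeta) * (E k + g k)) ->
  (forall k, E k <= (1 + zeta) * f (s k) + g k) ->
  \sum_j (tau j)%:R * (#|W j|)%:R <= alpha ->
  good_approx zeta alpha f E.
Proof.
move=> z0 f0 E0 g lower upper Walpha L HL.
have [[_ Lscale Ltri] _ Lsym] := HL.
have Lg : L g <= alpha * L (@e1 R n).
  apply: le_trans (mon_sym_norm_windows HL tau W) _.
  by rewrite ler_wpM2r ?mon_sym_norm_ge0.
have Lf : L f = L (fun k => f (s k)) by rewrite Lsym.
have z1 : 0 < 1 + zeta by lra.
have g0 k : 0 <= g k by apply: sumr_ge0 => j _; rewrite mulr_ge0.
split.
  rewrite lerBlDr ler_pdivrMl // Lf.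
  apply: (@le_trans _ _ (L (fun k => (1 + zeta) * (E k + g k)))).
    by apply: mon_sym_norm_le => // k; rewrite f0 lower.
  rewrite Lscale gtr0_norm // ler_pM2l //.
  by apply: le_trans (Ltri _ _) _; rewrite lerD2l.
apply: (@le_trans _ _ (L (fun k => (1 + zeta) * f (s k) + g k))).
  by apply: mon_sym_norm_le => // k; rewrite E0 upper.
apply: le_trans (Ltri _ _) _; rewrite Lscale gtr0_norm // -Lf.
by rewrite lerD2l.
Qed.

(** * Decreasing rearrangement through tail counts *)

Section Rearrangement.
Context (n T : nat).
Implicit Types (f g : 'I_n -> nat) (k : 'I_n).

Definition tail_count f (x : nat) : nat := \sum_(i < n) (x <= f i).

(* The (k+1)-st largest entry of f, for f bounded by T. *)
Definition rearr f (k : nat) : nat := \max_(x < T.+1 | (k < tail_count f x)%N) x.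

Lemma tail_count0 f : tail_count f 0 = n.
Proof. by rewrite /tail_count sum1_card card_ord. Qed.

Lemma tail_count_le f x : (tail_count f x <= n)%N.
Proof.
by rewrite -[leqRHS](tail_count0 f); apply: leq_sum => i _; rewrite leq_b1.
Qed.

Lemma tail_count_anti f x y : (x <= y)%N -> (tail_count f y <= tail_count f x)%N.
Proof.
move=> xy; apply: leq_sum => i _; case: (leqP y (f i)) => // yf.
by rewrite (leq_trans xy yf).
Qed.

(** A Galois connection, valid because tail counts decrease in x; the bound T makes the range of the
    maximum large enough. *)
Lemma leq_rearr f k x : (forall i, f i <= T)%N ->
  (x <= rearr f k)%N = (k < tail_count f x)%N.
Proof.
move=> fT; apply/idP/idP => [|kx]; last first.
  have xT : (x < T.+1)%N.
    rewrite ltnNge; apply/negP => Tx; move: kx.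
    by rewrite /tail_count big1 // => i _; have := fT i; case: (leqP x (f i)); lia.
  exact: (@leq_bigmax_cond _ _ (fun y : 'I_T.+1 => val y) (Ordinal xT)).
apply: contraTT; rewrite -leqNgt -ltnNge.
case: x => [|x]; first by rewrite tail_count0 leqNgt ltn_ord.
move=> kx; rewrite ltnS; apply/bigmax_leqP => y ky; rewrite -ltnS ltnNge.
apply/negP => /(tail_count_anti f) h; move: (leq_trans h kx).
by rewrite leqNgt ky.
Qed.

Lemma card_ord_lt (c : nat) : (c <= n)%N -> (\sum_(k < n) (k < c) = c)%N.
Proof.
move=> cn; rewrite -big_mkcond /= (big_ord_narrow cn) sum1_card card_ord //.
Qed.

Lemma tail_count_rearr f x : (forall i, f i <= T)%N ->
  tail_count (rearr f) x = tail_count f x.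
Proof.
move=> fT; rewrite -[RHS](card_ord_lt (tail_count_le f x)).
by apply: eq_bigr => k _; rewrite leq_rearr.
Qed.

(** The multiplicity of a value x is the drop of the tail count from x to x + 1, so equal tail
    counts mean equal multisets of entries. *)
Lemma tail_count_perm f g : (forall x, tail_count f x = tail_count g x) ->
  exists s : {perm 'I_n}, forall k, f k = g (s k).
Proof.
move=> fg; have count_f h x : count_mem x [tuple h i | i < n] =
    (tail_count h x - tail_count h x.+1)%N.
  rewrite /= count_map -sum1_count big_mkcond big_enum /=.
  apply/eqP; rewrite -(eqn_add2r (tail_count h x.+1)) subnK ?tail_count_anti //.
  rewrite /tail_count -big_split /=; apply/eqP/eq_bigr => i _.
  by case: ltngtP.
have /tuple_permP[s fs] : perm_eq [tuple f i | i < n] [tuple g i | i < n].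
  by apply/allP => x _; rewrite /= !count_f !fg.
exists s => k; have := congr1 (fun t => nth 0%N t k) fs.
by rewrite -!tnth_nth !tnth_mktuple.
Qed.

Lemma rearr_perm f : (forall i, f i <= T)%N ->
  exists s : {perm 'I_n}, forall k : 'I_n, rearr f k = f (s k).
Proof. by move=> fT; apply: tail_count_perm => x; exact: tail_count_rearr. Qed.

End Rearrangement.

Lemma card_ord_window (n a b : nat) :
  (#|[set k : 'I_n | (a <= k < b)%N]%SET| <= b - a)%N.
Proof.
rewrite cardE -(size_map val) -(size_iota a (b - a)).
apply: uniq_leq_size; first by rewrite map_inj_uniq ?enum_uniq //; exact: val_inj.
move=> x /mapP[k]; rewrite mem_enum inE mem_iota => /andP[ak kb] ->.
by rewrite ak /= subnKC // ltnW // (leq_ltn_trans ak).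
Qed.

(** * The sorted vector rebuilt from noisy counts *)

Section PostProcessing.
Context (R : realType) (n T m : nat) (tau : 'I_m -> nat) (B : nat).

(** The formula of [rearr] with estimated tail counts, from the histogram above B and from the
    levels otherwise. A maximum makes sense even if the noisy level counts are not monotone. *)
Definition assemble (h : 'I_n -> int) (c : 'I_m -> int) (k : 'I_n) : nat :=
  maxn (\max_(x < T.+1 | (B <= x)%N && (k < \sum_(i < n) (x%:Z <= h i)%R)%N) x)
       (\max_(j < m | (k%:Z < c j)%R) tau j).

Lemma bigmax_nat_le (I : finType) (P : pred I) (F : I -> nat) (r : R) :
  0 <= r -> (forall i, P i -> (F i)%:R <= r) -> (\max_(i | P i) F i)%:R <= r.
Proof.
move=> r0 Fr; apply: (@big_ind _ (fun x : nat => x%:R <= r)) => //.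
by move=> x y xr yr; rewrite /maxn; case: ifP.
Qed.

Variables (zeta : R) (Delta err : nat) (f : 'I_n -> nat).
Variables (h : 'I_n -> int) (c : 'I_m -> int).
Hypothesis zeta_gt0 : 0 < zeta.
Hypothesis f_le : forall i, (f i <= T)%N.
Hypothesis h_near : forall i, `|h i - (f i)%:Z| <= Delta%:Z.
Hypothesis c_near : forall j, `|c j - (tail_count f (tau j))%:Z| <= err%:Z.
Hypothesis B_large : (1 + zeta) * Delta%:R <= zeta * B%:R.
Hypothesis tau_cover : forall x : nat, (0 < x < B + Delta)%N ->
  exists j, (tau j <= x)%N /\ x%:R <= (1 + zeta) * (tau j)%:R.

(** The ranks k at which [k < c j] may disagree with the comparison to the true tail count. *)
Let window (j : 'I_m) : {set 'I_n} :=
  [set k : 'I_n | (tail_count f (tau j) - err <= k < tail_count f (tau j) + err)%N]%SET.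

Let slack (k : 'I_n) : R := \sum_j (tau j)%:R * (k \in window j)%:R.

Lemma slack_ge0 k : 0 <= slack k.
Proof. by apply: sumr_ge0 => j _; rewrite mulr_ge0. Qed.

Lemma slack_ge_tau k j : k \in window j -> (tau j)%:R <= slack k.
Proof.
move=> kW; rewrite /slack (bigD1 j) //= kW mulr1 lerDl.
by apply: sumr_ge0 => j' _; rewrite mulr_ge0.
Qed.

(** A reported level is correct unless k lies in its window. A histogram value x >= B exceeds the
    true entry by at most Delta, and [B_large] gives x <= (1 + zeta)(x - Delta). *)
Lemma assemble_upper (k : 'I_n) :
  (assemble h c k)%:R <= (1 + zeta) * (rearr T f k)%:R + slack k.
Proof.
have s0 := slack_ge0 k.
have r0 : 0 <= (rearr T f k)%:R :> R by [].
have zr0 : 0 <= zeta * (rearr T f k)%:R by rewrite mulr_ge0 // ltW.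
have rhs0 : 0 <= (1 + zeta) * (rearr T f k)%:R + slack k by nra.
rewrite /assemble /maxn; case: ifP => _; apply: bigmax_nat_le => //.
  move=> j kc; have [kj|kj] := ltnP k (tail_count f (tau j)).
    have : (tau j <= rearr T f k)%N by rewrite leq_rearr.
    rewrite -(ler_nat R); lra.
  have : (tau j)%:R <= slack k.
    by apply: slack_ge_tau; rewrite inE; have := c_near j; lia.
  lra.
move=> x /andP[Bx kx].
have : (x - Delta <= rearr T f k)%N.
  rewrite leq_rearr //; apply: leq_trans kx _; apply: leq_sum => i _.
  have [xh|//] := boolP (x%:Z <= h i).
  by rewrite lt0b; have := h_near i; lia.
have : B%:R <= x%:R :> R by rewrite ler_nat.
rewrite leq_subLR -(ler_nat R) natrD => Bx' xr.
have : zeta * B%:R <= zeta * x%:R by rewrite ler_pM2l.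
have : zeta * x%:R <= zeta * (Delta%:R + (rearr T f k)%:R) by rewrite ler_pM2l.
move: B_large; rewrite mulrDl mul1r !mulrDr; lra.
Qed.

Lemma assemble_lower (k : 'I_n) :
  (rearr T f k)%:R <= (1 + zeta) * ((assemble h c k)%:R + slack k).
Proof.
have s0 := slack_ge0 k; set y := rearr T f k.
have z1 : 0 < 1 + zeta by rewrite addr_gt0.
have a0 : 0 <= (assemble h c k)%:R :> R by [].
have kfy : (k < tail_count f y)%N by rewrite -(leq_rearr _ _ f_le).
(* The split is at B + Delta rather than B: above it, y - Delta is still at least B and so competes
   in the histogram maximum. *)
have [yB|yB] := ltnP y (B + Delta).
  have [y0|y0] := posnP y; first by rewrite y0 mulr_ge0 ?addr_ge0 // ltW.
  have [|j [jy yj]] := tau_cover (x := y); first by rewrite y0.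
  apply: (le_trans yj); rewrite ler_pM2l //.
  have kj := leq_trans kfy (tail_count_anti f jy).
  have [kc|kc] := boolP (k%:Z < c j).
    have : (tau j <= assemble h c k)%N.
      by rewrite /assemble leq_max (@leq_bigmax_cond _ _ tau j) ?orbT.
    by rewrite -(ler_nat R); lra.
  have : (tau j)%:R <= slack k.
    by apply: slack_ge_tau; rewrite inE; have := c_near j; lia.
  lra.
have yT : (y <= T)%N.
  by apply/bigmax_leqP => x _; rewrite -ltnS.
have xT : (y - Delta < T.+1)%N by lia.
have : (y - Delta <= assemble h c k)%N.
  rewrite /assemble leq_max; apply/orP; left.
  apply: (@leq_bigmax_cond _ _ (fun x : 'I_T.+1 => val x) (Ordinal xT)) => /=.
  apply/andP; split; first lia.
  apply: leq_trans kfy _; apply: leq_sum => i _.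
  have [yf|//] := leqP y (f i).
  by rewrite lt0b; have := h_near i; lia.
rewrite leq_subLR -(ler_nat R) natrD => yr.
have : B%:R + Delta%:R <= y%:R :> R by rewrite -natrD ler_nat.
move=> yB'.
have : zeta * (B%:R + Delta%:R) <= zeta * y%:R by rewrite ler_pM2l.
have : zeta * y%:R <= zeta * (Delta%:R + (assemble h c k)%:R) by rewrite ler_pM2l.
move: B_large; rewrite mulrDl mul1r !mulrDr.
have : 0 <= zeta * slack k by rewrite mulr_ge0 // ltW.
have : 0 <= zeta * Delta%:R by rewrite mulr_ge0 // ltW.
lra.
Qed.

Lemma assemble_good_approx (alpha : R) :
  2 * err%:R * \sum_j (tau j)%:R <= alpha ->
  good_approx zeta alpha (fun i => (f i)%:R) (fun k => (assemble h c k)%:R).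
Proof.
move=> Halpha; have [s fs] := rearr_perm f_le.
apply: (@good_approx_of_windows _ _ _ tau window _ _ _ _ s) => //.
- by move=> k; rewrite -fs assemble_lower.
- by move=> k; rewrite -fs assemble_upper.
apply: le_trans Halpha; rewrite mulr_sumr; apply: ler_sum => j _.
rewrite mulrC ler_wpM2r // -natrM ler_nat.
by apply: leq_trans (card_ord_window _ _ _) _; lia.
Qed.

End PostProcessing.

(** * Choice of the parameters *)

Section ParameterChoice.
Context (R : realType).
Implicit Types (n T : nat) (x z eps zeta : R).

Lemma ln_le_pred x : 0 < x -> ln x <= x - 1.
Proof.
move=> x0; have := @le_ln1Dx R (x - 1).
by rewrite addrCA subrr addr0; apply; rewrite ltrBrDr addNr.
Qed.

Lemma ln_ge_1BV x : 0 < x -> 1 - x^-1 <= ln x.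
Proof.
move=> x0; rewrite -lerN2 opprB -lnV ?posrE //.
by apply: ln_le_pred; rewrite invr_gt0.
Qed.

Lemma ln2_ge_half : 2^-1 <= ln (2 : R).
Proof. by have := @ln_ge_1BV 2 (ltr0Sn _ _); lra. Qed.

Lemma ln1D_ge_half z : 0 < z -> z <= 1 -> z / 2 <= ln (1 + z).
Proof.
move=> z0 z1; have z10 : 0 < 1 + z by lra.
apply: le_trans (ln_ge_1BV z10).
have -> : 1 - (1 + z)^-1 = z / (1 + z) by field; lra.
by rewrite ler_pM2l // lef_pV2 ?posrE //; lra.
Qed.

(** Integer noise above d is at least d + 1, whence the exponent. Truncation then costs nothing, and
    d = 0 when ln x < a. *)
Lemma exists_noise_level (a x : R) : 0 < a -> 1 <= x ->
  exists d : nat, x <= expR (a * d.+1%:R) /\ d%:R <= ln x / a.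
Proof.
move=> a0 x1; have lnx0 := ln_ge0 x1.
have q0 : 0 <= ln x / a by rewrite divr_ge0 // ltW.
exists (Num.trunc (ln x / a)); have /andP[lo hi] := truncn_itv q0; split=> //.
rewrite -[leLHS](@lnK R) ?posrE; last exact: lt_le_trans x1.
by rewrite ler_expR mulrC -ler_pdivrMr // ltW.
Qed.

Lemma exists_power_bracket (q x : R) (m : nat) : 1 <= x -> x < q ^+ m ->
  exists2 j, (j < m)%N & q ^+ j <= x < q ^+ j.+1.
Proof.
move=> x1; elim: m => [|m IH]; first by rewrite expr0 ltNge x1.
have [/IH[j jm jx] _|mx xm] := ltP x (q ^+ m); first by exists j => //; lia.
by exists m => //; rewrite mx.
Qed.

(** The levels are the powers of 1 + zeta rounded up and capped at S. An integer x between two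
    successive powers is at least the ceiling of the lower one. Their number follows from ln(1 +
    zeta) >= zeta / 2. *)
Lemma exists_thresholds zeta (S : nat) : 0 < zeta -> zeta <= 1 -> (0 < S)%N ->
  exists (m : nat) (tau : 'I_m -> nat),
    [/\ (0 < m)%N, m%:R <= 2 * ln S%:R / zeta + 1,
        forall j, (0 < tau j <= S)%N &
        forall x : nat, (0 < x < S)%N ->
          exists j, (tau j <= x)%N /\ x%:R <= (1 + zeta) * (tau j)%:R].
Proof.
move=> z0 z1 S0; have S1 : 1 <= S%:R :> R by rewrite ler1n.
have q1 : 1 <= 1 + zeta by lra.
have q0 : 0 < 1 + zeta by lra.
have r0 : 0 <= 2 * ln S%:R / zeta.
  by rewrite divr_ge0 ?mulr_ge0 ?ln_ge0 // ltW.
pose m := (Num.trunc (2 * ln S%:R / zeta)).+1.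
have /andP[lo hi] := truncn_itv r0.
have Sm : S%:R <= (1 + zeta) ^+ m.
  rewrite -ler_ln ?posrE ?exprn_gt0 ?ltr0n // lnXn // -[leRHS]mulr_natl.
  apply: (@le_trans _ _ (m%:R * (zeta / 2))); last first.
    by rewrite ler_wpM2l // ln1D_ge_half.
  by move/ltW: hi; rewrite -/m ler_pdivrMr //; lra.
pose c (j : nat) : nat := `|Num.ceil ((1 + zeta) ^+ j)|%N.
have cE j : (c j)%:Z = Num.ceil ((1 + zeta) ^+ j).
  by rewrite /c gez0_abs // -(ceil0 R) ceil_le // exprn_ge0 // ltW.
have c_ge j : (1 + zeta) ^+ j <= (c j)%:R.
  by have := ceil_ge ((1 + zeta) ^+ j); rewrite -cE.
have c_le j (x : nat) : (1 + zeta) ^+ j <= x%:R -> (c j <= x)%N.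
  by move=> jx; rewrite -lez_nat cE ceil_le_int.
have c_gt0 j : (0 < c j)%N.
  rewrite -(ltr0n R); apply: lt_le_trans (c_ge j).
  by rewrite exprn_gt0.
exists m, (fun j : 'I_m => minn (c j) S); split => //.
- by rewrite /m -natr1 lerD2r.
- by move=> j; rewrite leq_min c_gt0 S0 geq_minr.
move=> x /andP[x0 xS].
have xm : x%:R < (1 + zeta) ^+ m by apply: lt_le_trans Sm; rewrite ltr_nat.
have x1 : 1 <= x%:R :> R by rewrite ler1n.
have [j jm /andP[jx xj]] := exists_power_bracket x1 xm.
exists (Ordinal jm) => /=; split; first by rewrite geq_min c_le.
rewrite /minn; case: ifP => _.
  by apply: (le_trans (ltW xj)); rewrite exprS ler_pM2l.
apply: (@le_trans _ _ S%:R); first by rewrite ler_nat ltnW.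
by rewrite ler_peMl.
Qed.

Lemma ln_nat_ge_half (k : nat) : (1 < k)%N -> 2^-1 <= ln (k%:R : R).
Proof.
move=> k1; apply: le_trans ln2_ge_half _.
by rewrite ler_ln ?posrE ?ltr0n ?ler_nat //; lia.
Qed.

Lemma tree_depth_le n T : (0 < n)%N -> (0 < T)%N ->
  (trunc_log 2 T).+1%:R <= 2 * ln (2 * n * T)%:R :> R.
Proof.
move=> n0 T0; set D := (trunc_log 2 T).+1.
have : 2 ^+ D <= (2 * n * T)%:R :> R.
  rewrite -natrX ler_nat /D expnS -mulnA leq_mul2l /=.
  by rewrite (leq_trans (trunc_logP _ T0)) // leq_pmull.
have D0 : 0 <= D%:R :> R by [].
rewrite -ler_ln ?posrE ?exprn_gt0 ?ltr0n ?muln_gt0 ?n0 //.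
rewrite lnXn // -[leLHS]mulr_natr; have := ler_wpM2r D0 ln2_ge_half; lra.
Qed.

(** Here 5^D is the moment bound for D noise terms, and 6k comes from a union bound over k counters
    with failure probability 1/6. *)
Lemma ln_union_le (D k : nat) : (0 < k)%N ->
  ln (5 ^+ D * (6 * k)%:R : R) <= 4 * D%:R + 5 + ln k%:R.
Proof.
move=> k0; have k0' : 0 < k%:R :> R by rewrite ltr0n.
rewrite natrM mulrA !lnM ?posrE ?mulr_gt0 ?exprn_gt0 // lnXn // -[ln 5 *+ D]mulr_natr.
have D0 : 0 <= D%:R :> R by [].
have l5 : ln (5 : R) <= 4 by apply: (le_trans (ln_le_pred (ltr0Sn _ _))); lra.
have l6 : ln (6 : R) <= 5 by apply: (le_trans (ln_le_pred (ltr0Sn _ _))); lra.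
have := ler_wpM2r D0 l5; lra.
Qed.

Definition loglog n T eps zeta : R :=
  ln (2 + ln (2 * n * T)%:R) + ln (2 + eps^-1) + ln (2 + zeta^-1).

(** The last bound controls the logarithm of log^2(nT) / (eps zeta), the order of the cutoff B +
    Delta, and hence the number of levels. *)
Lemma loglog_bounds n T eps zeta : (0 < n)%N -> (0 < T)%N -> 0 < eps ->
  0 < zeta ->
  let lam := loglog n T eps zeta in
  [/\ 1 <= lam, ln zeta^-1 <= lam &
      2 * ln (ln (2 * n * T)%:R) + ln eps^-1 + ln zeta^-1 <= 2 * lam].
Proof.
move=> n0 T0 e0 z0 lam; rewrite /lam /loglog.
have nT : (1 < 2 * n * T)%N by nia.
have h := ln_nat_ge_half nT; set lg := ln _ in h *.
have ge x : 0 < x -> 2^-1 <= ln (2 + x) /\ ln x <= ln (2 + x).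
  move=> x0; split; last by rewrite ler_ln ?posrE; lra.
  by apply: le_trans ln2_ge_half _; rewrite ler_ln ?posrE; lra.
have [a1 a2] : 2^-1 <= ln (2 + lg) /\ ln lg <= ln (2 + lg) by apply: ge; lra.
have [b1 b2] := ge eps^-1 ltac:(by rewrite invr_gt0).
have [c1 c2] := ge zeta^-1 ltac:(by rewrite invr_gt0).
by split; lra.
Qed.

(** Here E = 1/eps and Z = 1/zeta. The product is of order lg^4 E^2 Z^3 lam^3: one lam comes from X
    and two from m, which enters both err and the sum of the levels. Finally Z^3 <= Z^5. *)
Lemma budget_le (lg lam E Z c1 c2 c3 d m S X err sum : R) :
  0 <= lg -> 0 <= lam -> 0 <= E -> 1 <= Z -> 0 <= c1 -> 0 <= c2 -> 0 <= c3 ->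
  0 <= d <= 2 * lg -> 0 <= m <= c2 * (lam * Z) ->
  0 <= S <= c1 * (lg ^+ 2 * E * Z) -> 0 <= X <= c3 * (lg * lam) ->
  0 <= err <= X * (16 * d * m * E) -> 0 <= sum <= m * S ->
  2 * err * sum <= 64 * c1 * c2 ^+ 2 * c3 * lg ^+ 4 * (E ^+ 2 * Z ^+ 5) * lam ^+ 3.
Proof.
move=> lg0 lam0 E0 Z1 c10 c20 c30 /andP[d0 dl] /andP[m0 ml] /andP[S0 Sl].
move=> /andP[X0 Xl] /andP[e0 el] /andP[s0 sl].
have Z0 : 0 <= Z by lra.
have h1 : err <= (c3 * (lg * lam)) * (16 * (2 * lg) * (c2 * (lam * Z)) * E).
  apply: (le_trans el); apply: ler_pM => //; first by rewrite !mulr_ge0.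
  by rewrite ler_wpM2r // ler_pM ?mulr_ge0 // ler_wpM2l.
have h2 : sum <= (c2 * (lam * Z)) * (c1 * (lg ^+ 2 * E * Z)).
  by apply: (le_trans sl); apply: ler_pM.
have h3 : err * sum <= ((c3 * (lg * lam)) * (16 * (2 * lg) * (c2 * (lam * Z)) * E)) *
    ((c2 * (lam * Z)) * (c1 * (lg ^+ 2 * E * Z))) by apply: ler_pM.
have Z35 : Z ^+ 3 <= Z ^+ 5 by rewrite ler_weXn2l.
rewrite -mulrA; apply: (@le_trans _ _
    (64 * c1 * c2 ^+ 2 * c3 * lg ^+ 4 * E ^+ 2 * lam ^+ 3 * Z ^+ 3)).
  have -> : 64 * c1 * c2 ^+ 2 * c3 * lg ^+ 4 * E ^+ 2 * lam ^+ 3 * Z ^+ 3 =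
      2 * (((c3 * (lg * lam)) * (16 * (2 * lg) * (c2 * (lam * Z)) * E)) *
      ((c2 * (lam * Z)) * (c1 * (lg ^+ 2 * E * Z)))) by ring.
  by rewrite ler_pM2l.
have -> : 64 * c1 * c2 ^+ 2 * c3 * lg ^+ 4 * (E ^+ 2 * Z ^+ 5) * lam ^+ 3 =
    64 * c1 * c2 ^+ 2 * c3 * lg ^+ 4 * E ^+ 2 * lam ^+ 3 * Z ^+ 5 by ring.
by rewrite ler_wpM2l // !mulr_ge0 ?exprn_ge0.
Qed.

(* When Delta = 0 the histogram is exact and no level is needed (m = 0): this
   case accounts for large eps, where the error bound tends to 0. *)
Lemma exists_parameters_le : exists C : R, 0 <= C /\
  forall (n D : nat) (eps zeta lg lam : R), (0 < n)%N -> (0 < D)%N ->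
  0 < eps -> 0 < zeta -> zeta <= 2^-1 ->
  2^-1 <= lg -> D%:R <= 2 * lg -> ln n%:R <= lg ->
  1 <= lam -> ln zeta^-1 <= lam ->
  2 * ln lg + ln eps^-1 + ln zeta^-1 <= 2 * lam ->
  exists (Delta B m err : nat) (tau : 'I_m -> nat),
    [/\ 5 ^+ D * (6 * n)%:R <= expR (eps / (4 * D%:R) / 2 * Delta.+1%:R),
        5 ^+ D * (6 * m)%:R <= expR (eps / (8 * D%:R * m%:R) / 2 * err.+1%:R),
        (1 + zeta) * Delta%:R <= zeta * B%:R,
        2 * err%:R * (\sum_j (tau j)%:R) <=
          C * lg ^+ 4 / (eps ^+ 2 * zeta ^+ 5) * lam ^+ 3 &
        (forall j, (0 < tau j)%N) /\
        forall x : nat, (0 < x < B + Delta)%N ->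
          exists j, (tau j <= x)%N /\ x%:R <= (1 + zeta) * (tau j)%:R].
Proof.
(* These bound, in order, the cutoff B + Delta, the number of levels and the logarithm in the union
   bound over levels. *)
pose c1 : R := 4 * (19 * 16); pose c2 : R := 2 * (c1 + 2) + 1.
pose c3 : R := 8 + 12 + 2 * c2 + 2 + 2.
have c1_gt0 : 0 < c1 by rewrite /c1 !mulr_gt0.
have c2_gt0 : 0 < c2 by rewrite /c2; lra.
have c3_gt0 : 0 < c3 by rewrite /c3; lra.
have [c1E c2E c3E] := And3 (erefl c1) (erefl c2) (erefl c3).
rewrite {2}/c1 in c1E; rewrite {2}/c2 in c2E; rewrite {2}/c3 in c3E.
clearbody c3 c2 c1.
exists (64 * c1 * c2 ^+ 2 * c3); split.
  by rewrite !mulr_ge0 ?exprn_ge0 // ltW.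
move=> n D eps zeta lg lam n0 D_gt0 e0 z0 zle lg_half Dlg ln_n lam1 lamz lam2.
have D0 : 0 < D%:R :> R by rewrite ltr0n.
have lg0 : 0 < lg by lra.
have lam0 : 0 < lam by lra.
have [c1_ge0 c2_ge0 c3_ge0] := And3 (ltW c1_gt0) (ltW c2_gt0) (ltW c3_gt0).
have [e_ge0 z_ge0 lg_ge0 lam_ge0] := And4 (ltW e0) (ltW z0) (ltW lg0) (ltW lam0).
have z1 : zeta <= 1 by lra.
have E0 : 0 < eps^-1 by rewrite invr_gt0.
have Z2 : 2 <= zeta^-1 by rewrite -[2]invrK lef_pV2 ?posrE ?invr_gt0.
have x1 : 1 <= 5 ^+ D * (6 * n)%:R :> R.
  by rewrite mulr_ege1 ?exprn_ege1 ?ler1n ?muln_gt0.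
have a1 : 0 < eps / (4 * D%:R) / 2 by rewrite !divr_gt0 ?mulr_gt0.
have [Delta [hDelta Delta_le]] := exists_noise_level a1 x1.
have [Delta0|Delta0] := posnP Delta.
  exists Delta, 0%N, 0%N, 0%N, (fun=> 1%N); split => //.
  - by rewrite muln0 mulr0 expR_ge0.
  - by rewrite Delta0 !mulr0.
  - by rewrite mulr0 mul0r ?(mulr_ge0, exprn_ge0, invr_ge0).
  by split=> // x; rewrite Delta0 addn0 ltn0 andbF.
have Delta_lg : Delta%:R <= 19 * 16 * (lg ^+ 2 * eps^-1).
  apply: (le_trans Delta_le).
  have -> : ln (5 ^+ D * (6 * n)%:R) / (eps / (4 * D%:R) / 2) =
      ln (5 ^+ D * (6 * n)%:R) * (8 * D%:R) * eps^-1 by field; lra.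
  rewrite [leRHS]mulrA ler_pM2r //.
  have := ln_union_le D n0; have := ln_ge0 x1 => l0 l1.
  (* 4D <= 8 lg, 5 <= 10 lg and ln n <= lg add up to 19 lg. *)
  have l2 : ln (5 ^+ D * (6 * n)%:R) <= 19 * lg by lra.
  apply: (@le_trans _ _ ((19 * lg) * (8 * (2 * lg)))).
    by rewrite ler_pM ?mulr_ge0 ?ler_wpM2l //; lra.
  by rewrite le_eqVlt; apply/orP; left; apply/eqP; ring.
have Delta1 : 1 <= Delta%:R :> R by rewrite ler1n.
have q0 : 0 <= 2 * Delta%:R * zeta^-1 by rewrite !mulr_ge0 // ltW // invr_gt0.
(* This makes zeta B at least 2 Delta, which dominates (1 + zeta) Delta. *)
pose B := (Num.trunc (2 * Delta%:R * zeta^-1)).+1.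
have /andP[Blo Bhi] := truncn_itv q0.
have B_large : (1 + zeta) * Delta%:R <= zeta * B%:R.
  have : 2 * Delta%:R <= zeta * B%:R.
    by rewrite [leRHS]mulrC -ler_pdivrMr // ltW.
  have : zeta * Delta%:R <= 1 * Delta%:R by rewrite ler_wpM2r.
  rewrite mulrDl; lra.
have DZ : 2 * Delta%:R <= Delta%:R * zeta^-1 by rewrite mulrC ler_pM2l ?ltr0n.
have S_le : (B + Delta)%:R <= c1 * (lg ^+ 2 * eps^-1 * zeta^-1).
  apply: (@le_trans _ _ (4 * (Delta%:R * zeta^-1))).
    by rewrite natrD /B -natr1; lra.
  rewrite c1E -!mulrA ler_pM2l // !mulrA ler_pM2r ?invr_gt0 //.
  by apply: (le_trans Delta_lg); rewrite !mulrA.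
have S0 : (0 < B + Delta)%N by rewrite addn_gt0 Delta0 orbT.
have [m [tau [m0 m_le tau_bd tau_cover]]] := exists_thresholds z0 z1 S0.
have lnS_le : ln (B + Delta)%:R <= (c1 + 2) * lam.
  apply: (@le_trans _ _ (ln (c1 * (lg ^+ 2 * eps^-1 * zeta^-1)))).
    by rewrite ler_ln ?posrE ?ltr0n // !mulr_gt0 ?exprn_gt0 // ?invr_gt0 //.
  rewrite !lnM ?posrE ?mulr_gt0 ?exprn_gt0 ?invr_gt0 //.
  have := ln_le_pred c1_gt0; have : c1 * 1 <= c1 * lam by rewrite ler_pM2l.
  rewrite (mulrDl c1); lra.
have lamZ : 1 <= lam * zeta^-1.
  by rewrite mulr_ege1 //; lra.
have m_lam : m%:R <= c2 * (lam * zeta^-1).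
  apply: (le_trans m_le); rewrite c2E.
  have -> : (2 * (c1 + 2) + 1) * (lam * zeta^-1) =
    2 * ((c1 + 2) * lam) * zeta^-1 + lam * zeta^-1 by ring.
  by rewrite lerD // ler_pM2r ?invr_gt0 // ler_pM2l.
have x2 : 1 <= 5 ^+ D * (6 * m)%:R :> R.
  by rewrite mulr_ege1 ?exprn_ege1 ?ler1n ?muln_gt0.
have m0' : 0 < m%:R :> R by rewrite ltr0n.
have a2 : 0 < eps / (8 * D%:R * m%:R) / 2 by rewrite !divr_gt0 ?mulr_gt0.
have [err [herr err_le]] := exists_noise_level a2 x2.
exists Delta, B, m, err, tau; split => //; last first.
  by split => // j; case/andP: (tau_bd j).
have Z0 : 0 < zeta^-1 by rewrite invr_gt0.
have X_le : ln (5 ^+ D * (6 * m)%:R) <= c3 * (lg * lam).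
  apply: (le_trans (ln_union_le D m0)).
  have lnm_le : ln m%:R <= c2 + lam + lam.
    apply: (@le_trans _ _ (ln (c2 * (lam * zeta^-1)))).
      by rewrite ler_ln ?posrE ?mulr_gt0.
    rewrite !lnM ?posrE ?mulr_gt0 //.
    have := ln_le_pred c2_gt0; have := ln_le_pred lam0; lra.
  set q := lg * lam.
  have q1 : lg <= q by rewrite ler_peMr.
  have q2 : lam <= 2 * q by rewrite /q mulrA ler_peMl //; lra.
  have q3 : c2 * 1 <= c2 * (2 * q) by rewrite ler_wpM2l //; lra.
  have -> : c3 * q = 24 * q + c2 * (2 * q) by rewrite c3E; ring.
  lra.
have X_ge0 := ln_ge0 x2.
set X := ln _ in err_le X_le X_ge0.
rewrite invfM -!exprVn.
apply: (@budget_le lg lam eps^-1 zeta^-1 c1 c2 c3 D%:R m%:R (B + Delta)%:R X) => //.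
- exact: ltW.
- by lra.
- by rewrite (ltW D0).
- by rewrite (ltW m0').
- by rewrite ler0n.
- by rewrite X_ge0.
- rewrite ler0n /= (le_trans err_le) // le_eqVlt; apply/orP; left.
  by apply/eqP; field; rewrite !gt_eqF.
rewrite sumr_ge0 //= -[X in X%:R * _]card_ord mulr_natl -sumr_const.
by apply: ler_sum => j _; rewrite ler_nat; case/andP: (tau_bd j).
Qed.

End ParameterChoice.

(** * The mechanism *)

Section Mechanism.
Context (R : realType) (n T D m : nat) (tau : 'I_m -> nat).
Context (eps : R) (Delta err B : nat).
Hypothesis T_gt0 : (0 < T)%N.
Hypothesis D_gt0 : (0 < D)%N.
Hypothesis T_lt : (T < 2 ^ D)%N.
Hypothesis eps_gt0 : 0 < eps.
Hypothesis tau_gt0 : forall j, (0 < tau j)%N.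

Local Notation kind := ('I_n + 'I_m)%type.
Local Notation node := ('I_D * 'I_T.+1 * kind)%type.
(* Large enough for the noise not to wrap around on the accurate event. *)
Let M : nat := (T + (Delta + err))%N.
Local Notation noise := {ffun node -> 'I_M.*2.+1}.
Implicit Types (u v : stream n T) (w z : noise) (h : kind) (N : 'I_T.+1).

(* Half of the privacy budget goes to the histogram (sensitivity 2 over all
   items) and half to the level counts (sensitivity 4 for each level). *)
Definition kind_rate h : R :=
  match h with
  | inl _ => eps / (4 * D%:R)
  | inr _ => eps / (8 * D%:R * m%:R)
  end.

Definition node_rate (x : node) : R := kind_rate x.2.

Definition exact_counts u : noise :=
  [ffun x => inZp (node_count (feature tau u) x)].

Definition estimate z h N : int :=
  \sum_(l < D) signed_rep (z (prefix_node h N l)).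

Definition release z : out R n T := fun t k =>
  (assemble T tau B (fun i => estimate z (inl i) (inord t.+1))
                    (fun j => estimate z (inr j) (inord t.+1)) k)%:R.

(** The whole output sequence is a function of one noisy vector of node counts, so privacy needs a
    single noise addition. *)
Definition mechanism u w : out R n T := release (exact_counts u + w).

Lemma kind_rate_ge0 h : 0 <= kind_rate h.
Proof.
by case: h => *; rewrite /= !(mulr_ge0, invr_ge0) //; exact: ltW.
Qed.

Lemma mechanism_causal u v (t : 'I_T) w :
  (forall s : 'I_T, (s <= t)%N -> u s = v s) ->
  mechanism u w t = mechanism v w t.
Proof.
move=> uv; have tT : (t.+1 < T.+1)%N by rewrite ltnS.
have eq_est h : estimate (exact_counts u + w) h (inord t.+1) =
    estimate (exact_counts v + w) h (inord t.+1).
  apply: eq_bigr => l _; rewrite !ffunE; congr (signed_rep (inZp _ + _)).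
  apply: node_count_causal => s; rewrite inordK // => st.
  by apply: (feature_causal _ _ _ st) => s'; exact: uv.
rewrite /mechanism /release; apply/funext => k.
congr (assemble _ _ _ _ _ _)%:R; apply/funext => x; exact: eq_est.
Qed.

Lemma counts_sensitivity u v : neighbors u v ->
  \sum_x node_rate x * (cyc_norm (exact_counts u x - exact_counts v x))%:R <= eps.
Proof.
move=> uv; rewrite sum_nodes.
pose sens h := (\sum_(s < T) (feature tau u h s != feature tau v h s))%N.
have D0 : 0 < D%:R :> R by rewrite ltr0n.
have eps_ge0 := ltW eps_gt0.
apply: (@le_trans _ _ (\sum_h kind_rate h * (D * sens h)%:R)).
  apply: ler_sum => h _.
  under eq_bigr do rewrite /node_rate /= -mulr_sumr.
  rewrite -mulr_sumr ler_wpM2l ?kind_rate_ge0 //.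
  under eq_bigr do rewrite -natr_sum.
  rewrite -natr_sum ler_nat.
  apply: leq_trans (node_sensitivity _ (feature tau u) (feature tau v) h).
  do 2 (apply: leq_sum => ? _).
  by rewrite !ffunE cyc_norm_inZpB.
rewrite big_sumType /=.
rewrite [leRHS](_ : eps = eps / 2 + eps / 2); last by field.
apply: lerD.
  rewrite -mulr_sumr -natr_sum -big_distrr /=.
  apply: (@le_trans _ _ (eps / (4 * D%:R) * (D * 2)%:R)).
    rewrite ler_wpM2l ?(mulr_ge0, invr_ge0) //.
    by rewrite ler_nat leq_mul2l feature_inl_sensitivity ?orbT.
  by rewrite natrM le_eqVlt; apply/orP; left; apply/eqP; field; rewrite gt_eqF.
apply: (@le_trans _ _ (\sum_(j < m) eps / (8 * D%:R * m%:R) * (D * 4)%:R)).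
  apply: ler_sum => j _; rewrite ler_wpM2l ?(mulr_ge0, invr_ge0) //.
  by rewrite ler_nat leq_mul2l feature_inr_sensitivity ?orbT.
rewrite sumr_const card_ord -[leLHS]mulr_natl natrM.
(* For m = 0 the level rate divides by zero, but there are no levels to sum over. *)
have [->|m0] := posnP m; first by rewrite mul0r divr_ge0 // ltW.
have m0' : 0 < m%:R :> R by rewrite ltr0n.
by rewrite le_eqVlt; apply/orP; left; apply/eqP; field; rewrite !gt_eqF.
Qed.

Lemma mechanism_private u v (S : set (out R n T)) : neighbors u v ->
  \sum_(w | `[< S (mechanism u w) >]) noise_mass node_rate w <=
  expR eps * \sum_(w | `[< S (mechanism v w) >]) noise_mass node_rate w.
Proof.
move=> uv.
apply: (@noise_private _ _ _ _ (fun x => kind_rate_ge0 x.2)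
  (fun z => `[< S (release z) >])).
exact: counts_sensitivity.
Qed.

Definition prefix_noise w h N : nat :=
  (\sum_(l < D) cyc_norm (w (prefix_node h N l)))%N.

Definition tolerance h : nat := if h is inl _ then Delta else err.

Lemma prefix_noise_tail h N :
  \sum_(w : noise | (tolerance h < prefix_noise w h N)%N) noise_mass node_rate w <=
  5 ^+ D / expR (kind_rate h / 2 * (tolerance h).+1%:R).
Proof.
pose U : {set node} := [set prefix_node h N l | l : 'I_D]%SET.
have cardU : #|U| = D by rewrite card_imset ?card_ord //; exact: prefix_node_inj.
have rateU x : x \in U -> node_rate x = kind_rate h by move=> /imsetP[l _ ->].
have := noise_concentration M (tolerance h) (kind_rate_ge0 h) rateU.
rewrite cardU; apply: le_trans.
rewrite le_eqVlt; apply/orP; left; apply/eqP; apply: eq_bigl => w.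
by rewrite big_imset //= => l l' _ _; exact: prefix_node_inj.
Qed.

Lemma estimate_near u w h N : (prefix_noise w h N <= tolerance h)%N ->
  `|estimate (exact_counts u + w) h N -
    (\sum_(s < T | (s < N)%N) feature tau u h s)%N%:Z| <= (tolerance h)%:Z.
Proof.
move=> small; rewrite -(sum_prefix_nodes _ _ _ T_lt) /estimate.
rewrite (big_morph Posz PoszD (erefl 0%:Z)) -sumrB.
apply: le_trans (ler_norm_sum _ _ _) _; apply: le_trans (_ : (prefix_noise w h N)%:Z <= _); last by [].
rewrite /prefix_noise (big_morph Posz PoszD (erefl 0%:Z)); apply: ler_sum => l _.
(* A node count is at most T and a single noise term at most the prefix noise, so their sum stays
   below M. *)
rewrite !ffunE; apply: signed_rep_inZpD; rewrite /M leq_add ?node_count_le //.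
apply: (@leq_trans (tolerance h)); last by case: (h) => _ /=; lia.
apply: leq_trans small; rewrite /prefix_noise (bigD1 l) //=; exact: leq_addr.
Qed.

Hypothesis Delta_large :
  5 ^+ D * (6 * n)%:R <= expR (eps / (4 * D%:R) / 2 * Delta.+1%:R).
Hypothesis err_large :
  5 ^+ D * (6 * m)%:R <= expR (eps / (8 * D%:R * m%:R) / 2 * err.+1%:R).

Let accurate_noise N : pred noise :=
  fun w => [forall h, (prefix_noise w h N <= tolerance h)%N].

Lemma union_bound_third (k : nat) (x : R) : 0 < x ->
  5 ^+ D * (6 * k)%:R <= x -> (5 ^+ D / x) *+ k <= 6^-1.
Proof.
move=> x0 kx; rewrite -mulr_natl mulrA ler_pdivrMr //.
by rewrite [leRHS]mulrC ler_pdivlMr //; move: kx; rewrite natrM; lra.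
Qed.

Lemma accurate_noise_likely N :
  2 / 3 <= \sum_(w | accurate_noise N w) noise_mass node_rate w.
Proof.
have := sum_noise_mass M node_rate; rewrite (bigID (accurate_noise N)) /=.
suff : \sum_(w | ~~ accurate_noise N w) noise_mass node_rate w <= 3^-1 by lra.
apply: (@le_trans _ _ (\sum_h \sum_(w : noise |
    (tolerance h < prefix_noise w h N)%N) noise_mass node_rate w)).
  rewrite (exchange_big_dep xpredT) //= big_mkcond; apply: ler_sum => w _.
  case: ifP => [|_]; last by apply: sumr_ge0 => *; exact: noise_mass_ge0.
  rewrite negb_forall => /existsP[h]; rewrite -ltnNge => bad.
  rewrite (bigD1 h) //= lerDl; apply: sumr_ge0 => *; exact: noise_mass_ge0.
(* The histogram and the level counters may each fail with probability 1/6. *)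
rewrite big_sumType /=; have -> : 3^-1 = 6^-1 + 6^-1 :> R by lra.
apply: lerD.
  apply: (@le_trans _ _ (\sum_(i < n)
      5 ^+ D / expR (eps / (4 * D%:R) / 2 * Delta.+1%:R))).
    by apply: ler_sum => i _; exact: (prefix_noise_tail (inl i)).
  by rewrite sumr_const card_ord union_bound_third ?expR_gt0.
apply: (@le_trans _ _ (\sum_(j < m)
    5 ^+ D / expR (eps / (8 * D%:R * m%:R) / 2 * err.+1%:R))).
  by apply: ler_sum => j _; exact: (prefix_noise_tail (inr j)).
by rewrite sumr_const card_ord union_bound_third ?expR_gt0.
Qed.

Lemma hits_le u i N : (hits u i N <= T)%N.
Proof.
apply: (@leq_trans (\sum_(s < T) 1)%N); last by rewrite sum1_card card_ord.
by rewrite /hits big_mkcond; apply: leq_sum => s _; case: ifP => // _; exact: leq_b1.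
Qed.

Variables (zeta alpha : R).
Hypothesis zeta_gt0 : 0 < zeta.
Hypothesis B_large : (1 + zeta) * Delta%:R <= zeta * B%:R.
Hypothesis alpha_large : 2 * err%:R * \sum_j (tau j)%:R <= alpha.
Hypothesis tau_cover : forall x : nat, (0 < x < B + Delta)%N ->
  exists j, (tau j <= x)%N /\ x%:R <= (1 + zeta) * (tau j)%:R.

Lemma mechanism_accurate u (t : 'I_T) w : accurate_noise (inord t.+1) w ->
  good_approx zeta alpha (freq R u t) (mechanism u w t).
Proof.
move=> /forallP wh; have tT : (t.+1 < T.+1)%N by rewrite ltnS.
have -> : freq R u t = fun i => (hits u i t.+1)%:R.
  by apply/funext => i; exact: freqE.
apply: (assemble_good_approx zeta_gt0 _ _ _ B_large tau_cover alpha_large).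
- by move=> i; have := @hits_le u i (inord t.+1); rewrite inordK.
- by move=> i; have := @estimate_near u w (inl i) _ (wh _); rewrite inordK.
move=> j; have := @estimate_near u w (inr j) _ (wh _).
by rewrite sum_feature_inr // inordK.
Qed.

Lemma exists_mechanism : exists (d : measure_display) (Omega : measurableType d)
    (P : probability Omega R) (A : stream n T -> Omega -> out R n T),
  [/\ mech_measurable A, continual A, eps_DP P A eps & accurate P A zeta alpha].
Proof.
pose p (w : noise) : {nonneg R} := NngNum (noise_mass_ge0 node_rate w).
have sum_p : \sum_w (p w)%:num = 1 := sum_noise_mass M node_rate.
pose sample (k : nat) : noise := nth 0 (enum {: noise}) k.
have probE (A : set noise) : finite_probability sum_p [set k | A (sample k)] =
    (\sum_(w | `[< A w >]) noise_mass node_rate w)%:E.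
  rewrite -(finite_lawE p 0 (fun w => `[< A w >])); congr (finite_law p _).
  by apply/seteqP; split => k /asboolP.
exists _, nat, (finite_probability sum_p), (fun u k => mechanism u (sample k)).
split.
(* Every subset of the discrete sample space is measurable. *)
- by move=> u S _.
- by move=> u v t k; exact: mechanism_causal.
- move=> u v uv S _; rewrite (probE (fun w => S (mechanism u w))).
  by rewrite (probE (fun w => S (mechanism v w))) -EFinM lee_fin mechanism_private.
move=> u t; exists [set k | accurate_noise (inord t.+1) (sample k)]; split => //.
  by move=> k /= /mechanism_accurate; apply.
rewrite (probE (fun w => accurate_noise (inord t.+1) w)) lee_fin.
apply: le_trans (accurate_noise_likely (inord t.+1)) _.
rewrite le_eqVlt; apply/orP; left; apply/eqP; apply: eq_bigl => w.
by rewrite asboolb.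
Qed.

End Mechanism.

Theorem mainTheorem18 (R : realType) :
  exists (C : R) (k : nat), forall (n T : nat) (eps zeta : R),
    (0 < n)%N -> (0 < T)%N -> 0 < eps -> 0 < zeta -> zeta <= 2^-1 ->
    exists (d : measure_display) (Omega : measurableType d)
           (P : probability Omega R) (A : stream n T -> Omega -> out R n T),
      [/\ mech_measurable A, continual A, eps_DP P A eps &
          accurate P A zeta (alpha_bound C k n T eps zeta)].
Proof.
have [C [C0 params]] := exists_parameters_le R.
exists C, 3%N => n T eps zeta n0 T0 e0 z0 zle.
have [lam1 lamz lam2] := loglog_bounds n0 T0 e0 z0.
have nT : (1 < 2 * n * T)%N by rewrite -mulnA (@leq_mul 2 1) // muln_gt0 n0.
have ln_n : ln n%:R <= ln (2 * n * T)%:R :> R.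
  rewrite ler_ln ?posrE ?ltr0n ?(ltnW nT) // ler_nat.
  by rewrite mulnAC leq_pmull // muln_gt0.
have [Delta [B [m [err [tau [hDelta herr hB halpha [tau0 tau_cover]]]]]]] :=
  params n (trunc_log 2 T).+1 _ _ _ _ n0 isT e0 z0 zle
    (ln_nat_ge_half _ nT) (tree_depth_le _ n0 T0) ln_n lam1 lamz lam2.
exact: (exists_mechanism T0 (ltn0Sn _) (trunc_log_ltn T (ltnSn 1)) e0 tau0 hDelta
  herr z0 hB halpha tau_cover).
Qed.
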